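(* Let $E$ be a finite dimensional vector space over a field. Suppose $\mathcal{B}$ is a family of subspaces of $E$ satisfying: (B1) $\mathcal{B}\neq\emptyset$; (B2) if $B_1,B_2\in\mathcal{B}$ and $B_1\subseteq B_2$, then $B_1=B_2$; (B3) if $B_1,B_2\in\mathcal{B}$, then for every codimension $1$ subspace $A$ of $B_1$ with $B_1\cap B_2\subseteq A$ there is a $1$-dimensional subspace $y$ of $B_2$ with $A+y\in\mathcal{B}$; (B4) for all subspaces $A,B\subseteq E$, if $I$ is a maximal intersection of a member of $\mathcal{B}$ with $A$ and $J$ is a maximal intersection of a member of $\mathcal{B}$ with $B$, then there is a maximal intersection of a member of $\mathcal{B}$ with $A+B$ that is contained in $I+J$. Let $\mathcal{I}_{\mathcal{B}}=\{I\subseteq E \text{ subspace}:\exists B\in\mathcal{B},\ I\subseteq B\}$. Then $\mathcal{I}_{\mathcal{B}}$ is the family of independent spaces of a $q$-matroid on $E$, and the family of bases of this $q$-matroid is $\mathcal{B}$. Conversely, if $\mathcal{B}_{\mathcal{I}}$ is the family of bases of a $q$-matroid on $E$ with family of independent spaces $\mathcal{I}$, then $\mathcal{B}_{\mathcal{I}}$ satisfies (B1), (B2), (B3), (B4), and $\mathcal{I}=\mathcal{I}_{\mathcal{B}_{\mathcal{I}}}$.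
   Context: A $q$-matroid is a pair $(E,r)$ where $E$ is a finite dimensional vector space over a field and $r$ is an integer-valued function on the subspaces of $E$ such that for all subspaces $A,B$: (r1) $0\le r(A)\le \dim A$; (r2) if $A\subseteq B$ then $r(A)\le r(B)$; (r3) $r(A+B)+r(A\cap B)\le r(A)+r(B)$. A subspace $A$ is independent if $r(A)=\dim A$, and a basis if it is independent and $r(A)=r(E)$. A $q$-matroid is determined by its family of independent spaces (via $r(A)=\max\{\dim I: I \text{ independent}, I\subseteq A\}$). In (B4), ''a maximal intersection of a member of $\mathcal{B}$ with $A$'' means a subspace of the form $B\cap A$, $B\in\mathcal{B}$, which is maximal with respect to inclusion among all such subspaces. *)

(* Defs.v *)
From HB Require Import structures.
From mathcomp Require Import all_boot all_order all_algebra.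
From mathcomp Require Import boolp classical_sets.
Set Implicit Arguments.
Unset Strict Implicit.
Unset Printing Implicit Defensive.
Import Order.TTheory GRing.Theory Num.Theory.
Local Open Scope ring_scope.
Local Open Scope classical_set_scope.

Record qmatroid (F : fieldType) (E : vectType F) := QMatroid {
  qrank : {vspace E} -> int;
  qrank_bounds : forall A : {vspace E}, 0 <= qrank A <= (\dim A)%:Z;
  qrank_mono : forall A B : {vspace E}, (A <= B)%VS -> qrank A <= qrank B;
  qrank_submod : forall A B : {vspace E},
    qrank (A + B)%VS + qrank (A :&: B)%VS <= qrank A + qrank B }.

Definition independents (F : fieldType) (E : vectType F) (M : qmatroid E) :
    set {vspace E} :=
  [set A | qrank M A = (\dim A)%:Z].

Definition bases (F : fieldType) (E : vectType F) (M : qmatroid E) :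
    set {vspace E} :=
  [set A | independents M A /\ qrank M A = qrank M fullv].

Section BasisAxioms.
Variables (F : fieldType) (E : vectType F).
Implicit Types (BB : set {vspace E}) (A B I J y : {vspace E}).

(* Maximality is with respect to inclusion, not dimension. *)
Definition maximal_intersection BB A I : Prop :=
  (exists2 B, BB B & I = (B :&: A)%VS) /\
  (forall B, BB B -> (I <= B :&: A)%VS -> (B :&: A)%VS = I).

Definition axiomB1 BB : Prop := BB !=set0.

Definition axiomB2 BB : Prop :=
  forall B1 B2, BB B1 -> BB B2 -> (B1 <= B2)%VS -> B1 = B2.

Definition axiomB3 BB : Prop :=
  forall B1 B2, BB B1 -> BB B2 ->
  forall A, (A <= B1)%VS -> \dim B1 = (\dim A).+1 -> (B1 :&: B2 <= A)%VS ->
  exists y, [/\ (y <= B2)%VS, \dim y = 1%N & BB (A + y)%VS].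

Definition axiomB4 BB : Prop :=
  forall A B I J, maximal_intersection BB A I -> maximal_intersection BB B J ->
  exists K, maximal_intersection BB (A + B)%VS K /\ (K <= I + J)%VS.

Definition subspaces_of_members BB : set {vspace E} :=
  [set I | exists2 B, BB B & (I <= B)%VS].

End BasisAxioms.

(* Main.v *)
Require Import Defs.
From mathcomp Require Import all_boot all_order all_algebra.
From mathcomp Require Import boolp classical_sets zify.

(** Given (B1)-(B4), the exchange (B3) moves a member B1 towards a member B2
    while keeping a prescribed subspace of B1, as long as that subspace and
    B1 :&: B2 do not span B1.  Starting from two maximal intersections I, J with
    A and carrying them to B1, B2 with \dim (B1 :&: B2) as large as possible, one
    gets B1 = I + B1 :&: B2 and B2 = J + B1 :&: B2, whence \dim I = \dim J.  So
    r(A), the dimension of any maximal intersection with A, is well defined, and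
    (B4) applied to extensions I, J of one maximal intersection with A :&: B
    gives submodularity.

    Conversely, in a q-matroid submodularity shows that a rank that does not
    increase under adding any line of A does not increase under adding A; hence
    independent spaces extend to independent spaces of full rank in A, and the
    maximal intersections with A are exactly the independent subspaces of A of
    rank r(A). *)

(** * Maxima of bounded functions, lines and hyperplanes *)

Section Subspaces.
Import GRing.Theory.
Variables (F : fieldType) (E : vectType F).
Implicit Types U V W : {vspace E}.

Lemma exists_argmax {T : Type} (P : T -> Prop) (f : T -> nat) (N : nat) (x0 : T) :
  (forall x, P x -> f x <= N) -> P x0 ->
  exists2 x, P x & forall y, P y -> f y <= f x.
Proof.
move=> fN Px0.
have exP : exists n, `[< exists2 x, P x & f x = n >].
  by exists (f x0); apply/asboolP; exists x0.
have leP n : `[< exists2 x, P x & f x = n >] -> n <= N.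
  by move=> /asboolP[x Px <-]; exact: fN.
case: (ex_maxnP exP leP) => m /asboolP[x Px fx] maxm.
exists x => // y Py; rewrite fx; apply: maxm.
by apply/asboolP; exists y.
Qed.

Lemma dim_add_line U (v : E) : v \notin U -> \dim (U + <[v]>)%VS = (\dim U).+1.
Proof.
move=> vU; have v0 : v != 0%R by apply: contraNneq vU => ->; rewrite mem0v.
rewrite dimv_disjoint_sum ?dim_vline ?v0 ?addn1 //.
apply/eqP; rewrite -subv0; apply/subvP => x /memv_capP[xU /vlineP[k xk]].
rewrite memv0 xk; have [->|k0] := eqVneq k 0%R; first by rewrite scale0r.
case/negP: vU; rewrite -[v](scalerK k0) -xk.
exact: memvZ.
Qed.

(** Take [H] of largest dimension among the spaces between [U] and [W] that do not contain [W]: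
    adding a vector of [W] outside [H] must then give all of [W]. *)
Lemma exists_hyperplane U W : (U <= W)%VS -> ~~ (W <= U)%VS ->
  exists H, [/\ (U <= H)%VS, (H <= W)%VS & \dim W = (\dim H).+1].
Proof.
move=> UW nWU.
have [||H [UH HW nWH] maxH] := @exists_argmax _
  (fun H => [/\ (U <= H)%VS, (H <= W)%VS & ~~ (W <= H)%VS])
  (fun H => \dim H) (\dim W) U.
- by move=> H [_ /dimvS].
- by split.
exists H; split=> //; case/subvPn: nWH => v vW vH.
have HvW : (H + <[v]> <= W)%VS by rewrite subv_add HW -memvE.
rewrite -(dim_add_line H v vH); congr (\dim _); apply/eqP.
rewrite eqEsubv HvW andbT; apply/negPn/negP => nW.
have := maxH (H + <[v]>)%VS; rewrite dim_add_line // ltnn => mx.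
suff: false by [].
by apply: mx; split=> //; apply: subv_trans (addvSl _ _).
Qed.

End Subspaces.

(** * From the basis axioms to a q-matroid *)

Section FromBases.
Variables (F : fieldType) (E : vectType F) (BB : set {vspace E}).
Hypotheses (B1 : axiomB1 BB) (B2 : axiomB2 BB) (B3 : axiomB3 BB) (B4 : axiomB4 BB).
Implicit Types A B C D I J K : {vspace E}.

Lemma exchange_towards C D K : BB C -> BB D -> (K <= C)%VS ->
  ~~ (C <= K + C :&: D)%VS ->
  exists C', [/\ BB C', \dim C' = \dim C, (K <= C')%VS &
                 \dim (C :&: D) < \dim (C' :&: D)].
Proof.
move=> BC BD KC nC.
have sC : (K + C :&: D <= C)%VS by rewrite subv_add KC capvSl.
have [H [sH HC dC]] := exists_hyperplane _ _ _ _ sC nC.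
move: sH; rewrite subv_add => /andP[KH CDH].
have [y [yD dy By]] := B3 C D BC BD H HC dC CDH.
(* Otherwise [H] itself would be a member properly contained in [C], against (B2). *)
have ynH : ~~ (y <= H)%VS.
  apply/negP => /addv_idPl yH; rewrite yH in By.
  by have := B2 H C By BC HC => eHC; move: dC; rewrite eHC; lia.
have dHy : \dim (H + y)%VS = \dim C.
  have lt : \dim H < \dim (H + y)%VS.
    by rewrite (ltn_leqif (dimv_leqif_sup (addvSl H y))) subv_add subvv.
  by move: dC lt (dimv_add_leqif H y).1; rewrite dy; lia.
exists (H + y)%VS; split=> //; first exact: subv_trans KH (addvSl _ _).
have sub : (C :&: D <= (H + y) :&: D)%VS.
  by rewrite subv_cap capvSr (subv_trans CDH (addvSl _ _)).
(* The growth is strict because the new intersection contains [y], while [C :&: D] lies in [H] and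
   [H] does not contain [y]. *)
rewrite ltn_neqAle (dimvS sub) andbT; apply: contra ynH => /eqP eqd.
have /eqP eCD : (C :&: D == (H + y) :&: D)%VS by rewrite eqEdim sub eqd leqnn.
by apply: subv_trans CDH; rewrite eCD subv_cap addvSr.
Qed.

(** Exchanges preserve dimension, so among members of the dimension of [C] take one meeting [D]
    most. It admits no further exchange with [K = 0], hence lies in [D] and equals it by (B2). *)
Lemma dim_members C D : BB C -> BB D -> \dim C = \dim D.
Proof.
move=> BC BD.
have [||C' [BC' dC'] maxC'] := @exists_argmax _
  (fun C' => BB C' /\ \dim C' = \dim C) (fun C' => \dim (C' :&: D)%VS) (\dim D) C.
- by move=> C' _; exact: dimvS (capvSr _ _).
- by [].
rewrite -dC'; congr (\dim _); apply: B2 => //; apply/negPn/negP => nC.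
have [|C'' [BC'' dC'' _]] := exchange_towards C' D 0%VS BC' BD (sub0v _).
  by rewrite add0v subv_cap subvv.
have := maxC' C''; rewrite dC'' => /(_ (conj BC'' dC')); lia.
Qed.

Lemma extend_intersection B A I : BB B -> (I <= B)%VS -> (I <= A)%VS ->
  exists2 J, maximal_intersection BB A J & (I <= J)%VS.
Proof.
move=> BBB IB IA.
have [||C [BC IC] maxC] := @exists_argmax _
  (fun C => BB C /\ (I <= C :&: A)%VS) (fun C => \dim (C :&: A)%VS) (\dim A) B.
- by move=> C _; exact: dimvS (capvSr _ _).
- by rewrite subv_cap IB IA.
exists (C :&: A)%VS => //; split; first by exists C.
move=> D BD sub; apply/eqP; rewrite eq_sym eqEdim sub maxC //.
by split=> //; exact: subv_trans IC sub.
Qed.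

Lemma dim_maximal_intersection A I J :
  maximal_intersection BB A I -> maximal_intersection BB A J -> \dim I = \dim J.
Proof.
move=> [[C0 BC0 eI] maxI] [[D0 BD0 eJ] maxJ].
have [||[C D] /= [BC BD IC JD] maxCD] := @exists_argmax _
  (fun CD => [/\ BB CD.1, BB CD.2, (I <= CD.1)%VS & (J <= CD.2)%VS])
  (fun CD => \dim (CD.1 :&: CD.2)%VS) (\dim (@fullv _ E)) (C0, D0).
- by move=> CD _; exact: dimvS (subvf _).
- by split=> //=; rewrite ?eI ?eJ capvSl.
have IA : (I <= A)%VS by rewrite eI capvSr.
have JA : (J <= A)%VS by rewrite eJ capvSr.
(* By maximality, every member containing [I] meets [A] exactly in [I]; likewise for [J]. *)
have eCA : (C :&: A)%VS = I by apply: maxI => //; rewrite subv_cap IC IA.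
have eDA : (D :&: A)%VS = J by apply: maxJ => //; rewrite subv_cap JD JA.
have sC : (C <= I + C :&: D)%VS.
  apply/negPn/negP => nC.
  have [C' [BC' _ IC' lt]] := exchange_towards C D I BC BD IC nC.
  by have := maxCD (C', D) (And4 BC' BD IC' JD) => /=; lia.
have sD : (D <= J + C :&: D)%VS.
  rewrite capvC; apply/negPn/negP => nD.
  have [D' [BD' _ JD' lt]] := exchange_towards D C J BD BC JD nD.
  have := maxCD (C, D') (And4 BC BD' IC JD') => /=.
  by rewrite capvC (capvC C); lia.
have {}sC : (I + C :&: D)%VS = C.
  by apply/eqP; rewrite eqEsubv sC subv_add IC capvSl.
have {}sD : (J + C :&: D)%VS = D.
  by apply/eqP; rewrite eqEsubv sD subv_add JD capvSr.
(* Both sides equal [A :&: C :&: D]. Together with [dim_members], the dimension formula for the two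
   sums then gives the claim. *)
have capE : (I :&: (C :&: D) = J :&: (C :&: D))%VS.
  have capA X Y : ((X :&: A) :&: (X :&: Y) = A :&: (X :&: Y))%VS.
    by rewrite (capvC X A) -capvA (capvA X X) capvv.
  by rewrite -eCA -eDA capA (capvC C D) capA.
have := dimv_sum_cap I (C :&: D); have := dimv_sum_cap J (C :&: D).
rewrite sC sD capE (dim_members C D BC BD); lia.
Qed.

Lemma exists_maximal_intersection A : exists I, maximal_intersection BB A I.
Proof.
case: B1 => B BBB.
by have [I mI _] := extend_intersection B A 0%VS BBB (sub0v _) (sub0v _); exists I.
Qed.

Lemma maximal_intersection_sub A I : maximal_intersection BB A I -> (I <= A)%VS.
Proof. by case=> [[B _ ->] _]; rewrite capvSr. Qed.

Lemma qmatroid_of_bases :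
  exists M : qmatroid E, independents M = subspaces_of_members BB /\ bases M = BB.
Proof.
have [m mP] := choice exists_maximal_intersection.
pose r (A : {vspace E}) : int := Posz (\dim (m A)).
have rE A I : maximal_intersection BB A I -> r A = Posz (\dim I).
  by move=> mI; rewrite /r (dim_maximal_intersection A (m A) I).
have m_member A : exists2 B, BB B & (m A <= B)%VS.
  by have [[B BBB ->] _] := mP A; exists B; rewrite ?capvSl.
have m_ext A B : (A <= B)%VS ->
    exists2 J, maximal_intersection BB B J & (m A <= J)%VS.
  move=> AB; have [C BC mC] := m_member A.
  apply: (extend_intersection C) => //.
  exact: subv_trans (maximal_intersection_sub _ _ (mP A)) AB.
have r1 A : (0 <= r A <= Posz (\dim A))%R.
  by rewrite /r; have := dimvS (maximal_intersection_sub _ _ (mP A)); lia.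
have r2 A B : (A <= B)%VS -> (r A <= r B)%R.
  by move=> AB; have [J mJ /dimvS] := m_ext A B AB; rewrite (rE B J mJ) /r; lia.
(* [I] and [J] both extend [m (A :&: B)], which therefore lies in [I :&: J], while (B4) bounds
   [r (A + B)] by the dimension of [I + J]. *)
have r3 A B : (r (A + B)%VS + r (A :&: B)%VS <= r A + r B)%R.
  have [I mI sI] := m_ext _ _ (capvSl A B).
  have [J mJ sJ] := m_ext _ _ (capvSr A B).
  have [K [mK /dimvS sK]] := B4 A B I J mI mJ.
  have dcap : \dim (m (A :&: B)%VS) <= \dim (I :&: J)%VS.
    by apply: dimvS; rewrite subv_cap sI.
  have := dimv_sum_cap I J.
  rewrite (rE _ _ mI) (rE _ _ mJ) (rE _ _ mK) /r; lia.
have indE : [set A | r A = Posz (\dim A)]%classic = subspaces_of_members BB.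
  apply/seteqP; split=> A /=.
    rewrite /r => -[eqd]; have [B BBB mB] := m_member A; exists B => //.
    suff <- : m A = A by [].
    by apply/eqP; rewrite eqEdim (maximal_intersection_sub _ _ (mP A)) eqd leqnn.
  (* A subspace [A] of a member is its own maximal intersection. *)
  move=> [B BBB AB]; apply: rE; split.
    by exists B => //; apply/esym/capv_idPr.
  by move=> C _ AsC; apply/eqP; rewrite eqEsubv AsC capvSr.
(* By (B2), each member is a maximal intersection with the whole space. *)
have rfull B : BB B -> r fullv = Posz (\dim B).
  move=> BBB; apply: rE; split; first by exists B => //; rewrite capvf.
  by move=> C BC; rewrite capvf => BsC; rewrite (B2 B C).
exists (QMatroid r1 r2 r3); split=> //.
apply/seteqP; split=> A /=; rewrite /bases /=.
  move=> [indA eqr]; have rA : r A = Posz (\dim A) by [].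
  have : [set A | r A = Posz (\dim A)]%classic A by [].
  rewrite indE => -[B BBB AB].
  suff -> : A = B by [].
  have [dAB] : Posz (\dim A) = Posz (\dim B) by rewrite -rA -(rfull B BBB).
  by apply/eqP; rewrite eqEdim AB dAB leqnn.
move=> BA; have indA : r A = Posz (\dim A).
  suff : [set A | r A = Posz (\dim A)]%classic A by [].
  by rewrite indE; exists A.
by split; rewrite ?(rfull A BA).
Qed.

End FromBases.

(** * From a q-matroid to the basis axioms *)

Section FromQMatroid.
Variables (F : fieldType) (E : vectType F) (M : qmatroid E).
Implicit Types A B C I J K X : {vspace E}.
Local Notation r := (qrank M).

Lemma qrank_le_dim A : (r A <= Posz (\dim A))%R.
Proof. by have /andP[] := qrank_bounds M A. Qed.

Lemma qrank_ge0 A : (0 <= r A)%R.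
Proof. by have /andP[] := qrank_bounds M A. Qed.

(** With a complement [B :\: A], submodularity bounds [r B] by [r A + r (B :\: A)], hence by
    [\dim A + \dim (B :\: A) = \dim B]. Since [r B = \dim B], equality holds throughout. *)
Lemma independents_sub A B : independents M B -> (A <= B)%VS -> independents M A.
Proof.
rewrite /independents /= => indB AB.
have := qrank_submod M A (B :\: A); rewrite addvC.
have -> : (B :\: A + A)%VS = B.
  by have := addv_diff_cap B A; rewrite (capv_idPr AB).
have := qrank_ge0 (A :&: (B :\: A)); have := qrank_le_dim (B :\: A).
have := dimv_cap_compl B A; rewrite (capv_idPr AB).
have := qrank_le_dim A; lia.
Qed.

(** Induction on a spanning list of [X]: [I + <[v]>] and [I + <<s>>] have rank at most [r I] and
    their intersection contains [I], so submodularity bounds the rank of their sum by [r I]. *)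
Lemma qrank_add_le I X : (forall v, v \in X -> (r (I + <[v]>)%VS <= r I)%R) ->
  (r (I + X)%VS <= r I)%R.
Proof.
move=> leI; rewrite -(span_basis (vbasisP X)).
have : {subset tval (vbasis X) <= X} by move=> v /vbasis_mem.
elim: (tval (vbasis X)) => [_|v s IHs sX]; first by rewrite span_nil addv0.
have {}IHs : (r (I + <<s>>)%VS <= r I)%R.
  by apply: IHs => w ws; apply: sX; rewrite inE ws orbT.
have := leI v (sX v (mem_head _ _)).
have := qrank_submod M (I + <[v]>) (I + <<s>>).
have -> : (I + <[v]> + (I + <<s>>) = I + <<v :: s>>)%VS.
  by rewrite span_cons -addvA (addvC <[v]>%VS) -addvA addvA addvv (addvC <<s>>%VS).
have : (r I <= r ((I + <[v]>) :&: (I + <<s>>))%VS)%R.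
  by apply: qrank_mono; rewrite subv_cap !addvSl.
lia.
Qed.

Lemma independent_augment I X : independents M I -> (r I < r (I + X)%VS)%R ->
  exists v, [/\ v \in X, v \notin I & independents M (I + <[v]>)%VS].
Proof.
rewrite /independents /= => indI lt.
have [v vX ltv] : exists2 v, v \in X & (r I < r (I + <[v]>)%VS)%R.
  apply: contrapT => nex; have := qrank_add_le I X.
  suff hle : forall v, v \in X -> (r (I + <[v]>)%VS <= r I)%R by move/(_ hle); lia.
  move=> v vX; case: (Num.Theory.lerP (r (I + <[v]>)%VS) (r I)) => // ltv.
  by case: nex; exists v.
have vI : v \notin I.
  by apply/negP; rewrite memvE => /addv_idPl vI; move: ltv; rewrite vI; lia.
exists v; split=> //=.
by have := qrank_le_dim (I + <[v]>); rewrite dim_add_line //; lia.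
Qed.

Lemma independent_extend I A : independents M I -> (I <= A)%VS ->
  exists J, [/\ independents M J, (I <= J)%VS, (J <= A)%VS & r J = r A].
Proof.
move=> indI IA.
have [||J [indJ IJ JA] maxJ] := @exists_argmax _
  (fun J => [/\ independents M J, (I <= J)%VS & (J <= A)%VS])
  (fun J => \dim J) (\dim A) I.
- by move=> J [_ _ /dimvS].
- by [].
exists J; split=> //; have leJA := qrank_mono M JA.
case: (Num.Theory.lerP (r A) (r J)) => [|lt]; first by lia.
have [|v [vA vJ indv]] := independent_augment J A indJ.
  by rewrite (addv_idPr JA).
suff /maxJ : [/\ independents M (J + <[v]>)%VS, (I <= J + <[v]>)%VS
                 & (J + <[v]> <= A)%VS] by rewrite dim_add_line ?ltnn.
by split=> //; [exact: subv_trans IJ (addvSl _ _) | rewrite subv_add JA -memvE].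
Qed.

Lemma independents0 : independents M 0%VS.
Proof. by rewrite /independents /=; have := qrank_bounds M 0%VS; rewrite dimv0; lia. Qed.

Lemma independent_in_basis I : independents M I -> exists2 B, bases M B & (I <= B)%VS.
Proof.
by move=> /(independent_extend I fullv)/(_ (subvf _))[B [? ? _ ?]]; exists B.
Qed.

Lemma maximal_intersection_basesP A I : maximal_intersection (bases M) A I <->
  [/\ independents M I, (I <= A)%VS & r I = r A].
Proof.
split=> [[[B [indB rB] eI] maxI] | [indI IA rI]].
  have IA : (I <= A)%VS by rewrite eI capvSr.
  have indI : independents M I.
    by apply: independents_sub indB _; rewrite eI capvSl.
  split=> //; have [J [indJ IJ JA rJ]] := independent_extend I A indI IA.
  have [C bC JC] := independent_in_basis J indJ.
  (* A basis [C] above [J] meets [A] in at least [J], so maximality of [I] forces [J = I]. *)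
  have JCA : (J <= C :&: A)%VS by rewrite subv_cap JC.
  have eC := maxI C bC (subv_trans IJ JCA).
  by rewrite -rJ; congr (r _); apply/eqP; rewrite eqEsubv IJ -eC.
have max C : bases M C -> (I <= C :&: A)%VS -> (C :&: A)%VS = I.
  move=> [indC _] IC; apply/eqP; rewrite eq_sym eqEdim IC.
  have := independents_sub (C :&: A) C indC (capvSl _ _).
  have := qrank_mono M (capvSr C A).
  by move: indI; rewrite /independents /=; lia.
split=> //; have [B bB IB] := independent_in_basis I indI.
by exists B => //; rewrite max ?subv_cap ?IB.
Qed.

(** Submodularity for [A] and [I + X]: their sum is [A + X], and their intersection contains [I],
    which already has rank [r A]. *)
Lemma qrank_add_spanning I A X : (I <= A)%VS -> r I = r A ->
  (r (A + X)%VS <= r (I + X)%VS)%R.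
Proof.
move=> IA rI; have := qrank_submod M A (I + X); rewrite addvA (addv_idPl IA).
have : (r I <= r (A :&: (I + X))%VS)%R.
  by apply: qrank_mono; rewrite subv_cap IA addvSl.
lia.
Qed.

Lemma bases_axiomB1 : axiomB1 (bases M).
Proof. by have [B bB _] := independent_in_basis _ independents0; exists B. Qed.

Lemma bases_axiomB2 : axiomB2 (bases M).
Proof.
move=> B C [indB rB] [indC rC] BC; apply/eqP; rewrite eqEdim BC.
by move: indB indC rB rC; rewrite /independents /=; lia.
Qed.

Lemma bases_axiomB3 : axiomB3 (bases M).
Proof.
move=> B C [indB rB] [indC rC] A AB dB _.
have indA := independents_sub A B indB AB.
(* The rank of [A] is one less than that of [B], hence less than [r C], so some vector of [C]
   augments [A]. *)
have [|v [vC vA indv]] := independent_augment A C indA.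
  have := qrank_mono M (addvSr A C).
  by move: indA indB; rewrite /independents /=; lia.
exists <[v]>%VS; split; first by rewrite -memvE.
  by rewrite dim_vline; case: eqP vA => // ->; rewrite mem0v.
split=> //; move: indv indB; rewrite /independents /= dim_add_line //; lia.
Qed.

Lemma bases_axiomB4 : axiomB4 (bases M).
Proof.
move=> A B I J /maximal_intersection_basesP[indI IA rI].
move=> /maximal_intersection_basesP[indJ JB rJ].
(* The witness is an independent space of full rank in [I + J]. It has rank [r (A + B)], because
   replacing [A] by [I] and [B] by [J] does not lower the rank of the sum. *)
have [K [indK _ KIJ rK]] := independent_extend 0 (I + J) independents0 (sub0v _).
exists K; split=> //; apply/maximal_intersection_basesP; split=> //.
  exact: subv_trans KIJ (addvS IA JB).
have := qrank_mono M (addvS IA JB).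
have := qrank_add_spanning I A J IA rI; have := qrank_add_spanning J B A JB rJ.
rewrite (addvC B) (addvC J); lia.
Qed.

Lemma independents_bases : independents M = subspaces_of_members (bases M).
Proof.
apply/seteqP; split=> A; first exact: independent_in_basis.
by move=> [B [indB _]]; exact: independents_sub.
Qed.

End FromQMatroid.

Theorem theorem6p1 (F : fieldType) (E : vectType F) :
  (forall BB : set {vspace E},
     axiomB1 BB -> axiomB2 BB -> axiomB3 BB -> axiomB4 BB ->
     exists M : qmatroid E,
       independents M = subspaces_of_members BB /\ bases M = BB) /\
  (forall M : qmatroid E,
     [/\ axiomB1 (bases M), axiomB2 (bases M), axiomB3 (bases M),
         axiomB4 (bases M) & independents M = subspaces_of_members (bases M)]).
Proof.
split=> [BB B1 B2 B3 B4 | M]; first exact: qmatroid_of_bases.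
split; [exact: bases_axiomB1 | exact: bases_axiomB2 | exact: bases_axiomB3
       | exact: bases_axiomB4 | exact: independents_bases].
Qed.
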